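(* Let $\Gamma$ be the infinite metric graph obtained by gluing the finite graphs $\Gamma_1,\Gamma_2,\Gamma_3,\dots$ in a chain, as defined in the context. Then $\Gamma$ does not admit a quasi-isometric embedding into any round ball space; that is, for every round ball space $Y$ there is no map $f\colon\Gamma\to Y$ for which there exist constants $L>0$ and $C\ge 0$ with $$L^{-1}d_\Gamma(x,y)-C\le d_Y(f(x),f(y))\le L\,d_\Gamma(x,y)+C\qquad\text{for all }x,y\in\Gamma.$$
   Context: Graphs are regarded as metric spaces (with edges included as segments of length 1) equipped with the path metric. The graphs $\Gamma_n$. $\Gamma_0$ is a single edge of length $1$; its two endpoints form its pair of primary vertices. Given $\Gamma_n$, take four copies of it, indexed by $i=0,1,2,3$; in the $i$-th copy let $p_i,q_i$ be a pair of primary vertices, i.e. a pair of vertices of valence $2^n$ in $\Gamma_n$ at distance $2^n$ from each other (the same pair in each copy). $\Gamma_{n+1}$ is obtained by identifying $q_i$ with $p_{i+1}$ for all $i$ modulo $4$, and is equipped with the path metric. (So $\Gamma_1$ is a 4-cycle; for $n\ge 1$, $\Gamma_n$ has exactly two pairs of primary vertices, namely the two pairs of opposite vertices among the four gluing vertices, and $\operatorname{diam}\Gamma_n=2^n$.) The graph $\Gamma$. For each $n\ge 1$ let $p_n,q_n$ be a pair of primary vertices of $\Gamma_n$. $\Gamma$ is obtained from the disjoint union of the $\Gamma_n$ by identifying $q_n$ with $p_{n+1}$ for every $n$, with the path metric: for $x\in\Gamma_m$, $y\in\Gamma_n$ with $m<n$, $d_\Gamma(x,y)=d_{\Gamma_m}(x,q_m)+\sum_{m<k<n}2^k+d_{\Gamma_n}(p_n,y)$,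 and $d_\Gamma=d_{\Gamma_n}$ on $\Gamma_n$. Round ball space: a metric space $(Y,d)$ such that for every $\varepsilon>0$ there exists $\delta_\varepsilon>0$ with $$\operatorname{diam}\left(B\left(x,\tfrac{1+\delta_\varepsilon}{2}d(x,y)\right)\cap B\left(y,\tfrac{1+\delta_\varepsilon}{2}d(x,y)\right)\right)<\varepsilon\, d(x,y)$$ for all distinct $x,y\in Y$, where $B(x,r)$ is the closed ball of radius $r$ about $x$ (using open balls gives an equivalent definition). *)

(* Defs.v *)
From HB Require Import structures.
From mathcomp Require Import all_boot all_order all_algebra.
From mathcomp Require Import all_classical all_reals all_analysis.

Set Implicit Arguments.
Unset Strict Implicit.
Unset Printing Implicit Defensive.

Import Order.TTheory GRing.Theory Num.Theory.

Local Open Scope classical_set_scope.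
Local Open Scope ring_scope.

(* Loops and multiple edges are allowed; the orientation given by [src] and
   [tgt] only serves to parametrize each edge by [0, 1]. *)
Record graph := Graph {
  vert : eqType;
  edge : Type;
  src : edge -> vert;
  tgt : edge -> vert }.

(* The metric realization of a graph: its vertices, together with an open
   segment of length 1 for each edge. *)
Definition graph_point (R : realType) (G : graph) : Type :=
  (vert G + edge G * {t : R | 0 < t < 1})%type.

(* The point with parameter t, for t in [0, 1], of the closed edge e. *)
Definition edge_point (R : realType) (G : graph) (e : edge G) (t : R) :
    graph_point R G :=
  if insub t is Some u then inr (e, u)
  else inl (if t <= 0 then src e else tgt e).

(* [path_length x y l]: x and y are joined by a piecewise linear path of
   length l, i.e. a finite concatenation of segments of closed edges. *)
Inductive path_length (R : realType) (G : graph) :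
    graph_point R G -> graph_point R G -> R -> Prop :=
| path_length_nil x : path_length x x 0
| path_length_cons (e : edge G) (s t : R) y l :
    0 <= s <= 1 -> 0 <= t <= 1 ->
    path_length (edge_point e t) y l ->
    path_length (edge_point e s) y (`|s - t| + l).

(* The path metric; [inf] is only meaningful on a connected graph, which is
   the case of all the graphs below. *)
Definition graph_dist (R : realType) (G : graph) (x y : graph_point R G) : R :=
  inf [set l | path_length x y l].

(* The graph obtained from the disjoint union of the G i by identifying q i
   with p (next i) for all i, assuming p i != q i and next injective. Its
   vertices are the gluing vertices, the i-th one being the common image of
   p i and of the q j with next j = i, and the vertices of each G i other than
   p i and q i. *)
Definition other_vert (I : eqType) (G : I -> graph)
    (p q : forall i, vert (G i)) (i : I) : eqType :=
  {v : vert (G i) | (v != p i) && (v != q i)}.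

Definition glue_vert (I : eqType) (G : I -> graph)
    (p q : forall i, vert (G i)) : eqType :=
  (I + {i : I & other_vert p q i})%type.

Definition glue_map (I : eqType) (next : I -> I) (G : I -> graph)
    (p q : forall i, vert (G i)) (i : I) (v : vert (G i)) : glue_vert p q :=
  if (insub v : option (other_vert p q i)) is Some u
  then inr (existT (other_vert p q) i u)
  else inl (if v == p i then i else next i).

Definition glue_graph (I : eqType) (next : I -> I) (G : I -> graph)
    (p q : forall i, vert (G i)) : graph :=
  @Graph (glue_vert p q) {i : I & edge (G i)}
    (fun e => glue_map next p q (src (projT2 e)))
    (fun e => glue_map next p q (tgt (projT2 e))).

(* A graph with four marked vertices in cyclic order. The marking on Gamma_n
   (n >= 1) is by its four gluing vertices, so that the ordered pairs
   (corner a, corner (opposite a)), for a in 'I_4, are exactly the ordered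
   pairs of primary vertices (vertices of valence 2^n at distance 2^n from each
   other). On the single edge Gamma_0 each endpoint is marked twice, which
   gives the same property. *)
Record cornered := Cornered {
  cgraph :> graph;
  corner : 'I_4 -> vert cgraph }.

Definition opposite (a : 'I_4) : 'I_4 := ordS (ordS a).

Definition single_edge : graph :=
  @Graph bool unit (fun=> false) (fun=> true).

Definition Gamma0 : cornered :=
  @Cornered single_edge (fun a : 'I_4 => (1 < a)%N).

Definition Gamma_step (G : cornered) (a : 'I_4) : cornered :=
  @Cornered
    (glue_graph (@ordS 4) (G := fun=> cgraph G)
      (fun=> corner G a) (fun=> corner G (opposite a)))
    (fun i => inl i).

(* c n selects the pair of primary vertices of Gamma_n used in the four copies
   of Gamma_n making up Gamma_(n+1). *)
Fixpoint Gamma_ (c : nat -> 'I_4) (n : nat) : cornered :=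
  if n is m.+1 then Gamma_step (Gamma_ c m) (c m) else Gamma0.

(* The chain Gamma_1, Gamma_2, ...; d n selects the pair of primary vertices
   p_n, q_n of Gamma_n used in the chain (d 0 is irrelevant). The index set nat
   is shifted by one: the n-th member of the glued family is Gamma_(n+1). *)
Definition Gamma (c d : nat -> 'I_4) : graph :=
  glue_graph S (G := fun n => Gamma_ c n.+1)
    (fun n => corner (Gamma_ c n.+1) (d n.+1))
    (fun n => corner (Gamma_ c n.+1) (opposite (d n.+1))).

(* The library's [closed_ball] is the closure of the open ball. *)
Definition cball (R : realType) (Y : metricType R) (x : Y) (r : R) : set Y :=
  [set z | mdist x z <= r].

Definition diam (R : realType) (Y : metricType R) (A : set Y) : \bar R :=
  ereal_sup [set (mdist z.1 z.2)%:E | z in A `*` A].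

Definition round_ball_space (R : realType) (Y : metricType R) : Prop :=
  forall eps : R, 0 < eps -> exists2 delta : R, 0 < delta &
    forall x y : Y, x <> y ->
      (diam (cball x ((1 + delta) / 2 * mdist x y) `&`
             cball y ((1 + delta) / 2 * mdist x y))
       < (eps * mdist x y)%:E)%E.

Definition quasi_isometric_embedding (R : realType) (X : Type)
    (dX : X -> X -> R) (Y : metricType R) (f : X -> Y) : Prop :=
  exists L C : R, [/\ 0 < L, 0 <= C &
    forall x y : X, L^-1 * dX x y - C <= mdist (f x) (f y) <= L * dX x y + C].

(* Main.v *)
(* Let u, v be the two corners other than a given pair p, q of opposite corners
   in a copy of Gamma_k. If the four sides of the square p, u, q, v were all
   mapped to distance at most (1 + delta) / 2 times d(f p, f q), the round ball
   condition would make d(f u, f v) small compared to 2^k, contradicting the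
   lower quasi-isometry bound as soon as 2^k is large compared to the constants.
   Hence the ratio of image distance to distance grows by a factor 1 + delta
   when passing from p, q to one of the sides, which is a primary pair of a copy
   of Gamma_(k-1). Iterating from Gamma_n down to a fixed level contradicts the
   upper bound for n large. *)

Require Import Defs.
From mathcomp Require Import all_boot all_order all_algebra.
From mathcomp Require Import all_classical all_reals all_analysis.
From mathcomp Require Import ring lra.

Set Implicit Arguments.
Unset Strict Implicit.
Unset Printing Implicit Defensive.

Import Order.TTheory GRing.Theory Num.Theory.

Local Open Scope classical_set_scope.
Local Open Scope ring_scope.

(** * Walks along edges, which bound the path metric from above *)

Definition adjacent (G : graph) (x y : vert G) : Prop :=
  exists e : edge G, (src e = x /\ tgt e = y) \/ (src e = y /\ tgt e = x).

Inductive walk (G : graph) : vert G -> vert G -> nat -> Prop :=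
| walk_nil x : walk x x 0
| walk_cons x y z n : adjacent x y -> walk y z n -> walk x z n.+1.

Lemma walk_cat (G : graph) (x y z : vert G) m n :
  walk x y m -> walk y z n -> walk x z (m + n)%N.
Proof.
elim=> [//|x' y' z' k xy _ IH /IH]; exact: walk_cons.
Qed.

Lemma walk_map (G H : graph) (phi : vert G -> vert H) :
  (forall x y, adjacent x y -> adjacent (phi x) (phi y)) ->
  forall x y n, walk x y n -> walk (phi x) (phi y) n.
Proof.
move=> adj_phi x y n; elim=> [u|u v w k uv _]; first exact: walk_nil.
by apply: walk_cons; apply: adj_phi.
Qed.

Lemma edge_point0 (R : realType) (G : graph) (e : edge G) :
  edge_point e (0 : R) = inl (src e).
Proof. by rewrite /edge_point insubF ?lexx// ltxx. Qed.

Lemma edge_point1 (R : realType) (G : graph) (e : edge G) :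
  edge_point e (1 : R) = inl (tgt e).
Proof. by rewrite /edge_point insubF ?ltxx ?andbF// ler10. Qed.

Lemma walk_path_length (R : realType) (G : graph) (x y : vert G) n :
  walk x y n -> @path_length R G (inl x) (inl y) n%:R.
Proof.
elim=> [u|u v w k [e uv] _ IH]; first exact: path_length_nil.
case: uv => -[su tv].
- have -> : k.+1%:R = `|0 - 1| + k%:R :> R by rewrite sub0r normrN1 nat1r.
  rewrite -su -(edge_point0 R); apply: path_length_cons; rewrite ?lexx ?ler01//.
  by rewrite edge_point1 tv.
- have -> : k.+1%:R = `|1 - 0| + k%:R :> R by rewrite subr0 normr1 nat1r.
  rewrite -tv -(edge_point1 R); apply: path_length_cons; rewrite ?lexx ?ler01//.
  by rewrite edge_point0 su.
Qed.

(** * Lipschitz functions, which bound the path metric from below *)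

Definition edge_lipschitz (R : realType) (G : graph) (h : vert G -> R) : Prop :=
  forall e, `|h (src e) - h (tgt e)| <= 1.

Definition affine_ext (R : realType) (G : graph) (h : vert G -> R)
    (x : graph_point R G) : R :=
  match x with
  | inl v => h v
  | inr (e, t) => (1 - val t) * h (src e) + val t * h (tgt e)
  end.

Lemma affine_ext_edge_point (R : realType) (G : graph) (h : vert G -> R)
    (e : edge G) (t : R) : 0 <= t <= 1 ->
  affine_ext h (edge_point e t) = (1 - t) * h (src e) + t * h (tgt e).
Proof.
move=> /andP[t0 t1]; rewrite /edge_point; case: insubP => [u _ <- //|].
rewrite negb_and -!leNgt /= => /orP[t0'|t1'].
  rewrite t0'; have -> : t = 0 by apply/eqP; rewrite eq_le t0 t0'.
  by ring.
have -> : t = 1 by apply/eqP; rewrite eq_le t1 t1'.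
by rewrite ler10; ring.
Qed.

(** The affine extension has slope at most 1 on every closed edge, so a segment changes its value by
    at most the length of the segment; the triangle inequality sums this along the path. *)
Lemma path_length_lipschitz (R : realType) (G : graph) (h : vert G -> R)
    (x y : graph_point R G) l : edge_lipschitz h -> path_length x y l ->
  `|affine_ext h x - affine_ext h y| <= l.
Proof.
move=> hlip; elim=> [u|e s t z k s01 t01 _ IH]; first by rewrite subrr normr0.
apply: le_trans (ler_distD (affine_ext h (edge_point e t)) _ _) _.
apply: lerD => //; rewrite !affine_ext_edge_point//.
have -> : (1 - s) * h (src e) + s * h (tgt e)
   - ((1 - t) * h (src e) + t * h (tgt e))
   = - (s - t) * (h (src e) - h (tgt e)) by ring.
by rewrite normrM normrN ler_piMr.
Qed.

Lemma path_length_ge0 (R : realType) (G : graph) (x y : graph_point R G) l :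
  path_length x y l -> 0 <= l.
Proof. by elim=> // e s t z k _ _ _ ?; rewrite addr_ge0. Qed.

Lemma graph_dist_le_walk (R : realType) (G : graph) (x y : vert G) n :
  walk x y n -> @graph_dist R G (inl x) (inl y) <= n%:R.
Proof.
move=> /(walk_path_length R) xy; apply: ge_inf => //.
by exists 0 => l /path_length_ge0.
Qed.

(* The walk is only needed because [inf] of the empty set is 0. *)
Lemma graph_dist_ge_lipschitz (R : realType) (G : graph) (h : vert G -> R)
    (x y : vert G) n : edge_lipschitz h -> walk x y n ->
  `|h x - h y| <= @graph_dist R G (inl x) (inl y).
Proof.
move=> hlip /(walk_path_length R) xy; apply: lb_le_inf; first by exists n%:R.
by move=> l /(path_length_lipschitz hlip).
Qed.

(** * Functions on glued graphs *)

Lemma glue_map_p (I : eqType) (next : I -> I) (G : I -> graph)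
    (p q : forall i, vert (G i)) i : glue_map next p q (p i) = inl i.
Proof. by rewrite /glue_map insubF eqxx. Qed.

Lemma glue_map_q (I : eqType) (next : I -> I) (G : I -> graph)
    (p q : forall i, vert (G i)) i : p i != q i ->
  glue_map next p q (q i) = inl (next i).
Proof.
by rewrite eq_sym => /negbTE qp; rewrite /glue_map insubF ?eqxx ?andbF// qp.
Qed.

Lemma adjacent_glue_map (I : eqType) (next : I -> I) (G : I -> graph)
    (p q : forall i, vert (G i)) i (x y : vert (G i)) : adjacent x y ->
  @adjacent (glue_graph next p q) (glue_map next p q x) (glue_map next p q y).
Proof.
case=> e xy; exists (existT (fun i => edge (G i)) i e) => /=.
by case: xy => -[<- <-]; [left|right].
Qed.

Definition glue_fun (R : realType) (I : eqType) (G : I -> graph)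
    (p q : forall i, vert (G i)) (g : I -> R) (h : forall i, vert (G i) -> R)
    (v : glue_vert p q) : R :=
  match v with
  | inl i => g i
  | inr w => h (tag w) (val (tagged w))
  end.

Lemma glue_funE (R : realType) (I : eqType) (next : I -> I) (G : I -> graph)
    (p q : forall i, vert (G i)) (g : I -> R) (h : forall i, vert (G i) -> R) :
  (forall i, h i (p i) = g i) -> (forall i, h i (q i) = g (next i)) ->
  forall i v, glue_fun g h (glue_map next p q v) = h i v.
Proof.
move=> hp hq i v; rewrite /glue_map; case: insubP => [u _ <- //|].
rewrite negb_and !negbK; case: eqP => [-> _|_ /= /eqP ->] /=.
- by rewrite hp.
- by rewrite hq.
Qed.

Lemma glue_fun_lipschitz (R : realType) (I : eqType) (next : I -> I)
    (G : I -> graph) (p q : forall i, vert (G i)) (g : I -> R)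
    (h : forall i, vert (G i) -> R) :
  (forall i, h i (p i) = g i) -> (forall i, h i (q i) = g (next i)) ->
  (forall i, edge_lipschitz (h i)) ->
  @edge_lipschitz R (glue_graph next p q) (glue_fun g h).
Proof.
move=> hp hq hlip [i e] /=.
by rewrite !(glue_funE hp hq); apply: hlip.
Qed.

(** Each member [j] other than [i] receives the constant [g j]. Around a cycle this forces [h] to
    agree at [p i] and [q i]; along a chain [g] may jump at [i]. *)
Lemma lipschitz_ext_glue (R : realType) (I : eqType) (next : I -> I)
    (G : I -> graph) (p q : forall i, vert (G i)) (g : I -> R) (i : I)
    (h : vert (G i) -> R) : edge_lipschitz h ->
  (forall j, j != i -> g (next j) = g j) ->
  h (p i) = g i -> h (q i) = g (next i) ->
  exists h' : vert (glue_graph next p q) -> R, [/\ edge_lipschitz h',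
    forall v : vert (G i), h' (glue_map next p q v) = h v &
    forall j, h' (inl j) = g j].
Proof.
move=> hlip g_next hp hq.
(* [untag] transports [v] along [j = i] and returns the default [g j] for every other index. *)
pose hh j (v : vert (G j)) : R :=
  untag (g j) h (existT (fun j => vert (G j)) j v).
have hhi : hh i = h.
  apply/funext => v.
  exact: (@untagE _ _ _ (g i) _ h (existT (fun j => vert (G j)) i v) erefl).
have hhj j : j != i -> hh j = fun=> g j.
  by move=> ji; apply/funext => v; rewrite /hh untag_dflt.
have hhp j : hh j (p j) = g j.
  by have [->|/hhj ->//] := eqVneq j i; rewrite hhi.
have hhq j : hh j (q j) = g (next j).
  by have [->|ji] := eqVneq j i; rewrite ?hhi// hhj// g_next.
exists (glue_fun g hh); split=> //; last first.
  by move=> v; rewrite (glue_funE hhp hhq) hhi.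
apply: glue_fun_lipschitz => // j.
have [->|/hhj ->] := eqVneq j i; first by rewrite hhi.
by move=> e; rewrite subrr normr0.
Qed.

(** * Corners and height functions of the finite graphs *)

Lemma opposite_neq (a : 'I_4) : a != opposite a.
Proof. by case: a => [[|[|[|[|]]]]]. Qed.

Lemma oppositeK (a : 'I_4) : opposite (opposite a) = a.
Proof. by apply/val_inj; case: a => [[|[|[|[|]]]]]. Qed.

Lemma corner_neq c n a :
  corner (Gamma_ c n) a != corner (Gamma_ c n) (opposite a).
Proof.
case: n => [|n] /=; first by case: a => [[|[|[|[|]]]]].
exact: opposite_neq.
Qed.

Definition copy_map c n (i : 'I_4) (v : vert (Gamma_ c n)) :
    vert (Gamma_ c n.+1) :=
  glue_map (@ordS 4) (G := fun=> cgraph (Gamma_ c n))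
    (fun=> corner (Gamma_ c n) (c n))
    (fun=> corner (Gamma_ c n) (opposite (c n))) (i := i) v.

Lemma copy_map_p c n i :
  copy_map i (corner (Gamma_ c n) (c n)) = corner (Gamma_ c n.+1) i.
Proof. exact: (glue_map_p _ (G := fun=> cgraph (Gamma_ c n))). Qed.

Lemma copy_map_q c n i :
  copy_map i (corner (Gamma_ c n) (opposite (c n)))
  = corner (Gamma_ c n.+1) (ordS i).
Proof.
apply: (glue_map_q _ (G := fun=> cgraph (Gamma_ c n))).
exact: corner_neq.
Qed.

Lemma adjacent_copy_map c n i (x y : vert (Gamma_ c n)) :
  adjacent x y -> adjacent (copy_map i x) (copy_map i y).
Proof. exact: (@adjacent_glue_map _ _ (fun=> cgraph (Gamma_ c n))). Qed.

(** Two successive sides of the square join opposite corners, and by induction each side has a walk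
    of half the length. *)
Lemma walk_corners c n a :
  walk (corner (Gamma_ c n) a) (corner (Gamma_ c n) (opposite a)) (2 ^ n).
Proof.
elim: n a => [|n IH] a.
  apply: walk_cons (walk_nil _); exists tt => /=.
  by case: a => [[|[|[|[|]]]]]//= ?; [left|left|right|right].
have side i : walk (corner (Gamma_ c n.+1) i) (corner (Gamma_ c n.+1) (ordS i))
    (2 ^ n).
  rewrite -(copy_map_p c n i) -copy_map_q.
  exact: walk_map (@adjacent_copy_map c n i) _ _ _ (IH (c n)).
rewrite expnS mul2n -addnn; exact: walk_cat (side _) (side _).
Qed.

(** On the [i]-th copy, interpolate between [g i] and [g (ordS i)] by an affine function of [H]; its
    coefficient is at most 1 in absolute value. *)
Lemma lipschitz_of_corners (R : realType) c n (g : 'I_4 -> R)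
    (H : vert (Gamma_ c n) -> R) : edge_lipschitz H ->
  H (corner (Gamma_ c n) (c n)) = 0 ->
  H (corner (Gamma_ c n) (opposite (c n))) = 2 ^+ n ->
  (forall i, `|g (ordS i) - g i| <= 2 ^+ n) ->
  exists2 h : vert (Gamma_ c n.+1) -> R, edge_lipschitz h &
    forall i, h (corner (Gamma_ c n.+1) i) = g i.
Proof.
move=> Hlip Hp Hq gle.
have p2 : 0 < 2 ^+ n :> R by rewrite exprn_gt0.
pose hh (i : 'I_4) (v : vert (Gamma_ c n)) : R :=
  g i + (g (ordS i) - g i) / 2 ^+ n * H v.
exists (glue_fun g hh) => //.
apply: (@glue_fun_lipschitz _ _ _ (fun=> cgraph (Gamma_ c n))) => i.
- by rewrite /hh Hp mulr0 addr0.
- by rewrite /hh Hq divfK ?gt_eqF// addrC subrK.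
move=> e; rewrite /hh opprD addrACA subrr add0r -mulrBr normrM normf_div.
rewrite (gtr0_norm p2) -[leRHS]mulr1 ler_pM//.
by rewrite ler_pdivrMr// mul1r.
Qed.

(** This is the distance between the corners [a] and [i] of the graph of level [n.+1]. *)
Definition height (R : realType) n (a i : 'I_4) : R :=
  if i == a then 0 else if i == opposite a then 2 ^+ n.+1 else 2 ^+ n.

Lemma height_step (R : realType) n (a i : 'I_4) :
  `|height R n a (ordS i) - height R n a i| <= 2 ^+ n.
Proof.
have p2 : 0 < 2 ^+ n :> R by rewrite exprn_gt0.
rewrite ler_norml /height exprS.
by case: a => [[|[|[|[|]]]]]//= ?; case: i => [[|[|[|[|]]]]]//= ?; lra.
Qed.

(** Such a function certifies that opposite corners are at distance at least [2 ^+ n]. The one for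
    the glued pair at level [n] is rescaled in the four copies to give the one at level [n.+1]. *)
Lemma exists_height (R : realType) c n a :
  exists H : vert (Gamma_ c n) -> R, [/\ edge_lipschitz H,
    H (corner (Gamma_ c n) a) = 0 &
    H (corner (Gamma_ c n) (opposite a)) = 2 ^+ n].
Proof.
elim: n a => [|n IH] a.
  exists (fun v => if v == corner (Gamma_ c 0) a then 0 else 1); split.
  - move=> e; case: ifP; case: ifP; rewrite ?subrr ?subr0 ?sub0r ?normrN
      ?normr0 ?normr1//.
  - by rewrite eqxx.
  - by rewrite eq_sym (negbTE (corner_neq _ _ _)).
have [H [Hlip Hp Hq]] := IH (c n).
have [h hlip hc] := lipschitz_of_corners Hlip Hp Hq (height_step R n a).
exists h; split=> //; first by rewrite hc /height eqxx.
by rewrite hc /height eq_sym (negbTE (opposite_neq _)) eqxx.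
Qed.

(* The height between two opposite corners takes the same value at the other
   two, so it extends by a constant outside a copy glued along those. *)
Lemma exists_transverse_height (R : realType) c n a :
  exists H : vert (Gamma_ c n.+1) -> R, [/\ edge_lipschitz H,
    H (corner (Gamma_ c n.+1) a) = H (corner (Gamma_ c n.+1) (opposite a)) &
    `|H (corner (Gamma_ c n.+1) (ordS a)) -
      H (corner (Gamma_ c n.+1) (opposite (ordS a)))| = 2 ^+ n.+1].
Proof.
have [H [Hlip Hp Hq]] := exists_height R c n (c n).
have [h hlip hc] := lipschitz_of_corners Hlip Hp Hq (height_step R n (ordS a)).
have p2 : 0 < 2 ^+ n.+1 :> R by rewrite exprn_gt0.
exists h; split=> //; rewrite !hc /height.
- by case: a {hc hlip h} => [[|[|[|[|]]]]].
- by rewrite eqxx eq_sym (negbTE (opposite_neq _)) eqxx sub0r normrN gtr0_norm.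
Qed.

(** * Copies of the finite graphs inside the chain *)

(* The extension property expresses that the image of [phi] is attached to the
   rest of H only at the images of x and y. *)
Definition attached_at (R : realType) (G H : graph) (phi : vert G -> vert H)
    (x y : vert G) : Prop :=
  (forall u v, adjacent u v -> adjacent (phi u) (phi v)) /\
  (forall h : vert G -> R, edge_lipschitz h -> h x = h y ->
   exists2 h' : vert H -> R, edge_lipschitz h' & forall v, h' (phi v) = h v).

(** A function with equal values at the glued pair extends by that constant to the other three
    copies. The result agrees at all four corners, so it extends further through [phi]. *)
Lemma attached_at_copy_map (R : realType) c n i a (H : graph)
    (phi : vert (Gamma_ c n.+1) -> vert H) :
  attached_at R phi (corner (Gamma_ c n.+1) a)
    (corner (Gamma_ c n.+1) (opposite a)) ->
  attached_at R (phi \o copy_map i) (corner (Gamma_ c n) (c n))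
    (corner (Gamma_ c n) (opposite (c n))).
Proof.
move=> [adj_phi ext_phi]; split=> [u v uv|h hlip hpq].
  by apply: adj_phi; apply: adjacent_copy_map.
have [h' [h'lip h'E h'c]] := @lipschitz_ext_glue R _ (@ordS 4)
  (fun=> cgraph (Gamma_ c n)) (fun=> corner (Gamma_ c n) (c n))
  (fun=> corner (Gamma_ c n) (opposite (c n)))
  (fun=> h (corner (Gamma_ c n) (c n))) i h hlip (fun _ _ => erefl)
  erefl (esym hpq).
have [|h2 h2lip h2E] := ext_phi h' h'lip; first by rewrite /= !h'c.
by exists h2 => // v; rewrite /= h2E h'E.
Qed.

Definition chain_map c d n (v : vert (Gamma_ c n.+1)) : vert (Gamma c d) :=
  glue_map S (fun n => corner (Gamma_ c n.+1) (d n.+1))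
    (fun n => corner (Gamma_ c n.+1) (opposite (d n.+1))) v.

Lemma attached_at_chain_map (R : realType) c d n :
  attached_at R (@chain_map c d n) (corner (Gamma_ c n.+1) (d n.+1))
    (corner (Gamma_ c n.+1) (opposite (d n.+1))).
Proof.
split=> [u v|h hlip hpq].
  exact: (@adjacent_glue_map _ _ (fun n => cgraph (Gamma_ c n.+1))).
have [h' [h'lip h'E _]] := @lipschitz_ext_glue R _ S
  (fun n => cgraph (Gamma_ c n.+1))
  (fun n => corner (Gamma_ c n.+1) (d n.+1))
  (fun n => corner (Gamma_ c n.+1) (opposite (d n.+1)))
  (fun=> h (corner (Gamma_ c n.+1) (d n.+1))) n h hlip (fun _ _ => erefl)
  erefl (esym hpq).
by exists h'.
Qed.

(** The height of the [n]-th member differs at its two gluing vertices, so [attached_at] does not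
    extend it; a chain is cut by each member, and a step function does. *)
Lemma graph_dist_chain_ge (R : realType) c d n :
  2 ^+ n.+1 <= @graph_dist R (Gamma c d)
    (inl (chain_map d (corner (Gamma_ c n.+1) (d n.+1))))
    (inl (chain_map d (corner (Gamma_ c n.+1) (opposite (d n.+1))))).
Proof.
have [H [Hlip Hp Hq]] := exists_height R c n.+1 (d n.+1).
pose g (j : nat) : R := if (j <= n)%N then 0 else 2 ^+ n.+1.
have [||| h [hlip hE _]] := @lipschitz_ext_glue R _ S
  (fun n => cgraph (Gamma_ c n.+1))
  (fun n => corner (Gamma_ c n.+1) (d n.+1))
  (fun n => corner (Gamma_ c n.+1) (opposite (d n.+1))) g n H Hlip.
- by move=> j jn; rewrite /g ltn_neqAle jn.
- by rewrite Hp /g leqnn.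
- by rewrite Hq /g ltnn.
have adj := (attached_at_chain_map R c d n).1.
have := graph_dist_ge_lipschitz hlip
  (walk_map adj (walk_corners c n.+1 (d n.+1))).
rewrite /chain_map !hE Hp Hq sub0r normrN ger0_norm// exprn_ge0.
Qed.

(** * Decay of the image distances by the round ball condition *)

Lemma mdist_lt_diam (R : realType) (Y : metricType R) (A : set Y) (r : R)
    (u v : Y) : (diam A < r%:E)%E -> A u -> A v -> mdist u v < r.
Proof.
move=> Ar Au Av; rewrite -lte_fin; apply: le_lt_trans Ar.
by apply: ereal_sup_ubound; exists (u, v).
Qed.

(* If the bound fails for the opposite corners [a] and [opposite a], then all
   four sides are so short that the images of the two other corners lie in
   both balls about the images of these. *)
Lemma opposite_corners_decay (R : realType) c (H : graph) (Y : metricType R)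
    (f : graph_point R H -> Y) (L C delta : R) (k0 : nat) :
  0 < L -> 0 <= C -> 0 < delta -> 2 * L * C < 2 ^+ k0 ->
  (forall x y, L^-1 * graph_dist x y - C <= mdist (f x) (f y)
    <= L * graph_dist x y + C) ->
  (forall x y : Y, x <> y ->
    (diam (cball x ((1 + delta) / 2 * mdist x y) `&`
           cball y ((1 + delta) / 2 * mdist x y))
     < ((2 * L * (L + C))^-1 * mdist x y)%:E)%E) ->
  forall m a (phi : vert (Gamma_ c (m + k0)) -> vert H),
  attached_at R phi (corner (Gamma_ c (m + k0)) a)
    (corner (Gamma_ c (m + k0)) (opposite a)) ->
  mdist (f (inl (phi (corner (Gamma_ c (m + k0)) a))))
        (f (inl (phi (corner (Gamma_ c (m + k0)) (opposite a)))))
    * (1 + delta) ^+ m <= (L + C) * 2 ^+ (m + k0).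
Proof.
move=> L0 C0 d0 k0P fqi fball.
have p2_ge1 n : 1 <= 2 ^+ n :> R by rewrite exprn_ege1// ler1n.
(* The additive constant is absorbed using [1 <= 2 ^+ n], whence the factor [L + C]. *)
have upper n a (phi : vert (Gamma_ c n) -> vert H) :
    attached_at R phi (corner (Gamma_ c n) a)
      (corner (Gamma_ c n) (opposite a)) ->
    mdist (f (inl (phi (corner (Gamma_ c n) a))))
      (f (inl (phi (corner (Gamma_ c n) (opposite a))))) <= (L + C) * 2 ^+ n.
  move=> [adj_phi _].
  have := graph_dist_le_walk R (walk_map adj_phi (walk_corners c n a)).
  rewrite natrX => dle.
  have /andP[_ /le_trans] := fqi (inl (phi (corner (Gamma_ c n) a)))
    (inl (phi (corner (Gamma_ c n) (opposite a)))).
  apply; rewrite mulrDl lerD// ?ler_pM2l// ler_peMr//.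
elim=> [|m IH] a phi phiP; first by rewrite expr0 mulr1; exact: upper.
pose k := (m + k0)%N.
pose F i := f (inl (phi (corner (Gamma_ c k.+1) i))).
rewrite leNgt; apply/negP => Dlarge.
rewrite -/k -/(F a) -/(F (opposite a)) in Dlarge.
set D := mdist _ _ in Dlarge.
have e0 : 0 < (1 + delta) ^+ m by rewrite exprn_gt0// addr_gt0.
(* The induction hypothesis gives half of the bound at level [k.+1], which by [Dlarge] is less than
   half of [D * (1 + delta) ^+ m.+1]; then [(1 + delta) ^+ m] cancels. *)
have side i : mdist (F i) (F (ordS i)) <= (1 + delta) / 2 * D.
  have := IH (c k) _ (attached_at_copy_map i phiP).
  rewrite /= copy_map_p copy_map_q -/(F i) -/(F (ordS i)) -/k => sle.
  rewrite -(ler_pM2r e0) (le_trans sle)//.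
  move: Dlarge; rewrite addSn -/k !exprS; lra.
have Dgt0 : 0 < D.
  rewrite ltNge; apply/negP => Dle0; move: Dlarge; apply/negP; rewrite -leNgt.
  apply: le_trans (_ : 0 <= _); last first.
    by rewrite mulr_ge0 ?exprn_ge0// addr_ge0// ltW.
  by rewrite mulr_le0_ge0// exprn_ge0// addr_ge0// ltW.
have xy : F a <> F (opposite a).
  by apply/eqP; rewrite -mdist_gt0.
have uvlt : mdist (F (ordS a)) (F (opposite (ordS a))) <
    (2 * L * (L + C))^-1 * D.
  apply: mdist_lt_diam (fball _ _ xy) _ _; split; rewrite /cball /=.
  - exact: side.
  - by rewrite metric_sym; apply: side.
  - have := side (opposite (ordS a)); rewrite metric_sym.
    by have -> : ordS (opposite (ordS a)) = a := oppositeK a.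
  - exact: side.
have uvge : L^-1 * 2 ^+ k.+1 - C <= mdist (F (ordS a)) (F (opposite (ordS a))).
  have [h [hlip hpq huv]] := exists_transverse_height R c k a.
  have [h' h'lip h'E] := phiP.2 h hlip hpq.
  have := graph_dist_ge_lipschitz h'lip
    (walk_map phiP.1 (walk_corners c k.+1 (ordS a))).
  rewrite !h'E huv => dge.
  have /andP[+ _] := fqi (inl (phi (corner (Gamma_ c k.+1) (ordS a))))
    (inl (phi (corner (Gamma_ c k.+1) (opposite (ordS a))))).
  apply: le_trans; rewrite lerB// ler_pM2l// invr_gt0//.
have Dle : D <= (L + C) * 2 ^+ k.+1 := upper _ _ _ phiP.
have LC0 : 0 < L + C by rewrite ltr_wpDr.
(* The factor [(L + C)^-1] of the chosen epsilon cancels the upper bound for [D]; what remains is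
   half of the main term in [uvge]. *)
have : (2 * L * (L + C))^-1 * D <= (2 * L)^-1 * 2 ^+ k.+1.
  rewrite invfM -mulrA ler_pM2l ?invr_gt0 ?mulr_gt0//.
  by rewrite mulrC ler_pdivrMr// mulrC.
(* Since [k0 <= k.+1], subtracting [C] costs at most the other half, so [uvge] contradicts the
   strict inequality [uvlt]. *)
have Cle : C <= (2 * L)^-1 * 2 ^+ k.+1.
  rewrite mulrC ler_pdivlMr ?mulr_gt0// mulrC.
  by rewrite (le_trans (ltW k0P))// ler_weXn2l ?ler1n// -addSn leq_addl.
rewrite invfM in Cle *; lra.
Qed.

(** * Choice of the level and conclusion *)

Lemma bernoulli_le (R : realType) (x : R) n :
  0 <= x -> 1 + n%:R * x <= (1 + x) ^+ n.
Proof.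
move=> x0; elim: n => [|n IH]; first by rewrite mul0r addr0 expr0.
have n0 : 0 <= n%:R * x ^+ 2 by rewrite mulr_ge0 ?exprn_ge0.
rewrite exprS -natr1; apply: le_trans (ler_wpM2l _ IH); last by rewrite addr_ge0.
have -> : (1 + x) * (1 + n%:R * x) = 1 + (n%:R + 1) * x + n%:R * x ^+ 2 by ring.
by rewrite lerDl.
Qed.

Theorem theorem5 (R : realType) (c d : nat -> 'I_4) (Y : metricType R)
    (hY : round_ball_space Y) :
  ~ exists f : graph_point R (Gamma c d) -> Y,
      quasi_isometric_embedding (@graph_dist R (Gamma c d)) f.
Proof.
move=> [f [L [C [L0 C0 fqi]]]].
have LC0 : 0 < L + C by rewrite ltr_wpDr.
have [|delta d0 fball] := hY (2 * L * (L + C))^-1.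
  by rewrite invr_gt0 !mulr_gt0.
have k0P : 2 * L * C < 2 ^+ Num.bound (2 * L * C) by exact: upper_nthrootP.
set k0 := Num.bound _ in k0P.
(* For [m] above this threshold, [m%:R * delta] exceeds [2 * L * (L + C)], as needed for the
   Bernoulli bound at the end. *)
set B := 2 * L * (L + C) / delta.
have BP : B < (Num.bound B)%:R.
  by apply: archi_boundP; rewrite divr_ge0 ?mulr_ge0 ?ltW.
set m := Num.bound B in BP.
(* Member [m + k0] of the chain has level [(m + k0).+1], that is [m.+1 + k0], which allows [m.+1]
   steps of decay. *)
have := opposite_corners_decay L0 C0 d0 k0P fqi fball (m := m.+1)
  (attached_at_chain_map R c d (m + k0)).
have /andP[+ _] := fqi
  (inl (chain_map d (corner (Gamma_ c (m + k0).+1) (d (m + k0).+1))))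
  (inl (chain_map d (corner (Gamma_ c (m + k0).+1) (opposite (d (m + k0).+1))))).
set D := mdist _ _ => Dge Dle.
have dge := graph_dist_chain_ge R c d (m + k0).
have p2 : 0 < 2 ^+ (m + k0).+1 :> R by rewrite exprn_gt0.
have Cle : C <= (2 * L)^-1 * 2 ^+ (m + k0).+1.
  rewrite mulrC ler_pdivlMr ?mulr_gt0// mulrC.
  by rewrite (le_trans (ltW k0P))// ler_weXn2l ?ler1n// -addSn leq_addl.
have D2 : (2 * L)^-1 * 2 ^+ (m + k0).+1 <= D.
  apply: le_trans Dge.
  have : L^-1 * 2 ^+ (m + k0).+1 <= L^-1 * graph_dist
    (inl (chain_map d (corner (Gamma_ c (m + k0).+1) (d (m + k0).+1))))
    (inl (chain_map d
      (corner (Gamma_ c (m + k0).+1) (opposite (d (m + k0).+1))))).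
    by rewrite ler_pM2l ?invr_gt0.
  by rewrite invfM in Cle *; lra.
have e0 : 0 < (1 + delta) ^+ m.+1 by rewrite exprn_gt0// addr_gt0.
(* Inserting [D2] into the decay bound cancels the power of 2 and leaves a bound not involving
   [m]. *)
have : (1 + delta) ^+ m.+1 <= 2 * L * (L + C).
  rewrite -(ler_pM2l p2).
  have := le_trans (ler_wpM2r (ltW e0) D2) Dle.
  rewrite addSn -[leLHS]mulrA [leLHS]mulrC ler_pdivrMr ?mulr_gt0// => /le_trans; apply.
  by rewrite le_eqVlt; apply/orP; left; apply/eqP; ring.
apply/negP; rewrite -ltNge (lt_le_trans _ (bernoulli_le m.+1 (ltW d0)))//.
move: BP; rewrite /B ltr_pdivrMr// => /lt_le_trans; apply.
by rewrite -natr1 mulrDl mul1r; lra.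
Qed.
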